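(* Let $\partial X = D \sqcup N$ be a disjoint decomposition with both $D$ and $N$ non-empty. For $f \in L(X^o)$ and $g \in L(\partial X)$, there is a unique $u \in L(X)$ such that $\Delta u = f$ on $X^o$, $u = g|_{D}$ on $D$, and $\partial_{\vec n}u = g|_{N}$ on $N$. The solution is as follows: let $\tilde f \in L(X^o \cup N)$ be given by $\tilde f|_{X^o} = f$ and $\tilde f|_{N} = -g|_{N}$. Then $$u|_{X^o \cup N} = -G_{X^o\cup N} \bigl( \tilde f - P_{X^o \cup N,\, D}\,g|_{D}\bigr) \quad\text{and}\quad u|_{D} = g|_{D}.$$
   Context: Let $(X,E)$ be a finite directed graph with $|X|\ge 2$, $E\subset X^2$ without loops, which is strongly connected. Each edge $(x,y)\in E$ carries a weight $a(x,y)>0$, and $a(x,y)=0$ if $(x,y)\notin E$. Put $m(x)=\sum_y a(x,y)$, $p(x,y)=a(x,y)/m(x)$, $P=(p(x,y))_{x,y\in X}$. $L(B)$ is the space of functions $B\to\mathbb{C}$ (column vectors), $Pu(x)=\sum_y p(x,y)u(y)$, and $\Delta=P-I$. The boundary $\partial X$ is a non-empty subset of $X$, and $X^o=X\setminus\partial X$. The outer normal derivative is $\partial_{\vec n}u(x)=-\Delta u(x)$ for $x\in\partial X$. For $A,B\subset X$, $P_{A,B}=(p(x,y))_{x\in A,y\in B}$ and $P_A=P_{A,A}$. For $A\subsetneq X$, $G_A=(I_A-P_A)^{-1}=\sum_{n\ge0}P_A^n$ (the inverse exists and the series converges). *)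

(* Defs.v *)
From HB Require Import structures.
From mathcomp Require Import all_boot all_order all_algebra.
From mathcomp Require Import reals.
From mathcomp Require Import complex.

Set Implicit Arguments.
Unset Strict Implicit.
Unset Printing Implicit Defensive.

Import Order.TTheory GRing.Theory Num.Theory.
Local Open Scope ring_scope.
Local Open Scope complex_scope.

(* (E, a) makes X a strongly connected, loopless, positively weighted digraph *)
Record weighted_digraph (R : realType) (X : finType) (E : rel X)
    (a : X -> X -> R) : Prop := WeightedDigraph {
  wd_card : (2 <= #|X|)%N;
  wd_irrefl : irreflexive E;
  wd_strong : forall x y, connect E x y;
  wd_pos : forall x y, E x y -> 0 < a x y;
  wd_zero : forall x y, ~~ E x y -> a x y = 0 }.

(* L(B): column vectors indexed by B, through the enumeration enum_val of B.
   L(X) itself is Lsp R [set: X]. *)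
Definition Lsp (R : realType) (X : finType) (B : {set X}) : Type :=
  'cV[R[i]]_#|B|.

(* The value f(x) for x in B; 0 for x outside B (the sum has at most one term,
   since enum_val is injective with image B). *)
Definition Lval (R : realType) (X : finType) (B : {set X}) (f : Lsp R B)
    (x : X) : R[i] :=
  \sum_(i < #|B| | enum_val i == x) f i 0.

(* f|_A, meaningful when A is a subset of the domain B of f. *)
Definition restr (R : realType) (X : finType) (B A : {set X}) (f : Lsp R B) :
    Lsp R A :=
  \col_(i < #|A|) Lval f (enum_val i).

Definition wmass (R : realType) (X : finType) (a : X -> X -> R) (x : X) : R :=
  \sum_y a x y.

Definition tprob (R : realType) (X : finType) (a : X -> X -> R) (x y : X) : R :=
  a x y / wmass a x.

(* P_{A,B} *)
Definition Pmx (R : realType) (X : finType) (a : X -> X -> R) (A B : {set X}) :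
    'M[R[i]]_(#|A|, #|B|) :=
  \matrix_(i < #|A|, j < #|B|) (tprob a (enum_val i) (enum_val j))%:C.

Definition laplacian (R : realType) (X : finType) (a : X -> X -> R)
    (u : Lsp R [set: X]) : Lsp R [set: X] :=
  (Pmx a [set: X] [set: X] - 1%:M) *m u.

Definition normal_deriv (R : realType) (X : finType) (a : X -> X -> R)
    (bd : {set X}) (u : Lsp R [set: X]) : Lsp R bd :=
  restr bd (- laplacian a u : Lsp R [set: X]).

(* G_A = (I_A - P_A)^{-1}, for A a proper subset of X. The matrix is then
   invertible (Green_unit below), so invmx is a genuine inverse. *)
Definition Green (R : realType) (X : finType) (a : X -> X -> R) (A : {set X}) :
    'M[R[i]]_#|A| :=
  invmx (1%:M - Pmx a A A).

(* The function on A :|: N equal to f on A and to - g on N, for A and N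
   disjoint and N a subset of the domain B of g. *)
Definition glue_opp (R : realType) (X : finType) (A B N : {set X})
    (f : Lsp R A) (g : Lsp R B) : Lsp R (A :|: N) :=
  \col_(i < #|A :|: N|)
    (if enum_val i \in A then Lval f (enum_val i) else - Lval g (enum_val i)).

Lemma wmass_gt0 (R : realType) (X : finType) (E : rel X) (a : X -> X -> R) :
  weighted_digraph E a -> forall x, 0 < wmass a x.
Proof.
case=> X2 Eirr Econ apos azero x.
have a_ge0 u v : 0 <= a u v.
  by case: (boolP (E u v)) => [/apos/ltW|/azero->].
have [y yx] : exists y, y != x.
  apply/existsP; rewrite -negb_forall; apply: contraL X2 => /forallP h.
  rewrite -ltnNge ltnS -(cards1 x) -cardsT subset_leq_card //.
  by apply/subsetP => y _; rewrite inE; apply/h.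
case/connectP: (Econ x y) => -[|z s] /=.
  by move=> _ eyx; rewrite eyx eqxx in yx.
case/andP => Exz _ _; rewrite /wmass (bigD1 z) //=.
by apply: ltr_pwDl; [apply: apos | apply: sumr_ge0].
Qed.

Lemma Lval_enum (R : realType) (X : finType) (B : {set X}) (f : Lsp R B)
    (i : 'I_#|B|) : Lval f (enum_val i) = f i 0.
Proof.
rewrite /Lval (bigD1 i) //= big1 ?addr0 // => j /andP[/eqP/enum_val_inj->].
by rewrite eqxx.
Qed.

Lemma Lval_out (R : realType) (X : finType) (B : {set X}) (f : Lsp R B) x :
  x \notin B -> Lval f x = 0.
Proof.
move=> xB; rewrite /Lval big1 // => j /eqP jx.
by rewrite -jx enum_valP in xB.
Qed.

Lemma Lval_restr (R : realType) (X : finType) (B A : {set X}) (f : Lsp R B) x :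
  x \in A -> Lval (restr A f) x = Lval f x.
Proof. by move=> xA; rewrite -(enum_rankK_in xA xA) Lval_enum mxE. Qed.

Lemma Lsp_ext (R : realType) (X : finType) (B : {set X}) (f g : Lsp R B) :
  {in B, Lval f =1 Lval g} -> f = g.
Proof.
move=> fg; apply/matrixP => i j; rewrite ord1 -!Lval_enum.
exact/fg/enum_valP.
Qed.

Lemma glue_opp_l (R : realType) (X : finType) (A B N : {set X})
    (f : Lsp R A) (g : Lsp R B) : restr A (glue_opp N f g) = f.
Proof.
apply: Lsp_ext => x xA; rewrite Lval_restr //.
have xAN : x \in A :|: N by rewrite inE xA.
by rewrite -(enum_rankK_in xAN xAN) Lval_enum mxE enum_rankK_in ?xA.
Qed.

Lemma glue_opp_r (R : realType) (X : finType) (A B N : {set X})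
    (f : Lsp R A) (g : Lsp R B) : [disjoint A & N] ->
  restr N (glue_opp N f g) = - restr N g.
Proof.
move=> dAN; apply/matrixP => i j; rewrite !mxE.
have xN := enum_valP i; move: (enum_val i) xN => x xN.
have xAN : x \in A :|: N by rewrite inE xN orbT.
rewrite -{1}(enum_rankK_in xAN xAN) Lval_enum mxE enum_rankK_in //.
by rewrite (disjointFl dAN xN).
Qed.

Lemma Green_unit (R : realType) (X : finType) (E : rel X) (a : X -> X -> R)
    (A : {set X}) :
  weighted_digraph E a -> A \proper [set: X] -> 1%:M - Pmx a A A \in unitmx.
Proof.
move=> hG /properP[_ [z _ zA]].
have m_gt0 := wmass_gt0 hG; case: hG => _ _ Econ apos azero.
have p_ge0 x y : 0 <= tprob a x y.
  rewrite divr_ge0 ?(ltW (m_gt0 _)) //.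
  by case: (boolP (E x y)) => [/apos/ltW|/azero->].
have p_sum x : \sum_y tprob a x y = 1.
  by rewrite -mulr_suml divff // gt_eqF //; apply: m_gt0.
rewrite -unitmx_tr -row_free_unit -kermx_eq0; apply/negPn/negP => ker_neq0.
set v := nz_row (kermx (1%:M - Pmx a A A)^T).
have v_neq0 : v != 0 by rewrite nz_row_eq0.
have vB : v *m (1%:M - Pmx a A A)^T = 0.
  by apply/sub_kermxP; rewrite nz_row_sub.
pose w : Lsp R A := v^T.
have wP : w = Pmx a A A *m w.
  apply: subr0_eq; rewrite -{1}[w]mul1mx -mulmxBl.
  by rewrite -[_ *m w]trmxK trmx_mul trmxK vB trmx0.
have avg x : x \in A -> Lval w x = \sum_y (tprob a x y)%:C * Lval w y.
  move=> xA; rewrite -{1}(enum_rankK_in xA xA) Lval_enum wP mxE.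
  rewrite [RHS](bigID (mem A)) /= [X in _ + X]big1 ?addr0; last first.
    by move=> y /Lval_out->; rewrite mulr0.
  rewrite [RHS]big_enum_val; apply: eq_bigr => j _.
  by rewrite mxE enum_rankK_in // Lval_enum -wP.
pose h x : R := complex.Re `|Lval w x|.
have hE x : (h x)%:C = `|Lval w x| by rewrite /h normc_def.
have h_avg x : x \in A -> h x <= \sum_y tprob a x y * h y.
  move=> xA.
  suff : (h x)%:C <= (\sum_y tprob a x y * h y)%:C by rewrite lecR.
  rewrite hE avg // rmorph_sum /=.
  apply: le_trans (ler_norm_sum _ _ _) _; apply: ler_sum => y _.
  rewrite normrM -hE ger0_norm ?ler0c // -rmorphM.
  exact: lexx.
have hout x : x \notin A -> h x = 0.
  by move=> xA; rewrite /h Lval_out // normr0.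
pose x0 := [arg max_(x > z) h x]%O.
have hx0 x : h x <= h x0.
  by rewrite /x0; case: arg_maxP => // y _ ymax; apply: ymax.
have h_gt0 : 0 < h x0.
  have [i wi] : exists i, w i 0 != 0.
    apply/existsP; apply: contraR v_neq0; rewrite negb_exists => /forallP w0.
    apply/eqP/matrixP => i j; rewrite ord1.
    by move: (w0 j); rewrite negbK !mxE => /eqP.
  apply: lt_le_trans (hx0 (enum_val i)).
  suff : 0 < (h (enum_val i))%:C by rewrite ltcR.
  by rewrite hE Lval_enum normr_gt0.
have step x y : E x y -> h x = h x0 -> h y = h x0.
  move=> Exy hx; have xA : x \in A.
    by apply: contraLR h_gt0 => /hout; rewrite hx => ->; rewrite ltxx.
  have t_ge0 u : 0 <= tprob a x u * (h x0 - h u).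
    by rewrite mulr_ge0 ?subr_ge0.
  have : \sum_u tprob a x u * (h x0 - h u) <= 0.
    under eq_bigr do rewrite mulrBr.
    by rewrite sumrB -mulr_suml p_sum mul1r -{1}hx subr_le0 h_avg.
  rewrite le_eqVlt ltNge sumr_ge0 //= orbF psumr_eq0 //.
  move/allP/(_ y (mem_index_enum _)); rewrite /= mulf_eq0 => /orP[|].
    by rewrite gt_eqF // divr_gt0 ?apos.
  by rewrite subr_eq0 => /eqP.
have hz : h z = h x0.
  have walk s : forall x, h x = h x0 -> path E x s -> h (last x s) = h x0.
    elim: s => //= y s IHs x hx /andP[Exy]; apply: IHs.
    exact: step Exy hx.
  by case/connectP: (Econ x0 z) => s Es ->; apply: walk.
by rewrite -hz hout // ltxx in h_gt0.
Qed.

(* Main.v *)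
Require Import Defs.
From mathcomp Require Import all_boot all_order all_algebra.
From mathcomp Require Import reals.
From mathcomp Require Import complex.

Set Implicit Arguments.
Unset Strict Implicit.
Unset Printing Implicit Defensive.

Import Order.TTheory GRing.Theory Num.Theory.
Local Open Scope ring_scope.

(** The Neumann condition on N is the Poisson equation in disguise: since the
normal derivative is minus the Laplacian, prescribing it on N prescribes the
Laplacian there. Together, the interior equation and the Neumann condition say
that the Laplacian of u equals ftilde on S, the complement of D
([glue_opp_eqP]), so that only a Dirichlet problem with boundary D remains.

Splitting the rows of P indexed by S into their columns in S and in D gives,
on S, Delta u = P_{S,D} u_D - (I - P_S) u_S ([restr_laplacian]). As D is not
empty, S is a proper subset of X, and I - P_S is invertible ([Green_unit], by
the maximum principle on a strongly connected graph); hence the Dirichlet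
problem is equivalent to the announced formula for u_S ([dirichlet_solP]).
Existence and uniqueness follow because a function on X is the same as a pair
of functions on S and D ([glue_restr], [restr_inj]). *)

Lemma LvalB (R : realType) (X : finType) (B : {set X}) (f h : Lsp R B) x :
  Lval (f - h : Lsp R B) x = Lval f x - Lval h x.
Proof. by rewrite /Lval -sumrB; apply: eq_bigr => i _; rewrite !mxE. Qed.

Lemma LvalN (R : realType) (X : finType) (B : {set X}) (f : Lsp R B) x :
  Lval (- f : Lsp R B) x = - Lval f x.
Proof. by rewrite /Lval -sumrN; apply: eq_bigr => i _; rewrite mxE. Qed.

Lemma restrN (R : realType) (X : finType) (B A : {set X}) (f : Lsp R B) :
  restr A (- f : Lsp R B) = - restr A f.
Proof. by apply/matrixP => i j; rewrite !mxE LvalN. Qed.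

Lemma restr_restr (R : realType) (X : finType) (B A C : {set X})
    (f : Lsp R B) : C \subset A -> restr C (restr A f) = restr C f.
Proof.
move=> /subsetP CA; apply: Lsp_ext => x xC.
by rewrite !Lval_restr // CA.
Qed.

Lemma restr_inj (R : realType) (X : finType) (B A C : {set X})
    (f h : Lsp R B) : B \subset A :|: C ->
  restr A f = restr A h -> restr C f = restr C h -> f = h.
Proof.
move=> /subsetP BAC eA eC; apply: Lsp_ext => x /BAC; rewrite inE.
by case/orP => xin; rewrite -(Lval_restr f xin) -(Lval_restr h xin) ?eA ?eC.
Qed.

Lemma glue_restr (R : realType) (X : finType) (S D : {set X}) (hS : S = ~: D)
    (w : Lsp R S) (h : Lsp R D) :
  exists u : Lsp R [set: X], restr S u = w /\ restr D u = h.
Proof.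
(* Functions vanish outside their domains, so the values can simply be added. *)
pose u : Lsp R [set: X] :=
  \col_i (Lval w (enum_val i) + Lval h (enum_val i)).
have uE x : Lval u x = Lval w x + Lval h x.
  have xT : x \in [set: X] by rewrite inE.
  by rewrite -{1}(enum_rankK_in xT xT) Lval_enum mxE enum_rankK_in.
exists u; split; apply: Lsp_ext => x xin; rewrite Lval_restr // uE.
  by rewrite (Lval_out h) ?addr0 //; move: xin; rewrite hS inE.
by rewrite (Lval_out w) ?add0r // hS inE negbK.
Qed.

Lemma Lval_Pmx (R : realType) (X : finType) (a : X -> X -> R) (A B : {set X})
    (h : Lsp R B) x : x \in A ->
  Lval (Pmx a A B *m h : Lsp R A) x
    = \sum_(y in B) (tprob a x y)%:C%C * Lval h y.
Proof.
move=> xA; rewrite -{1}(enum_rankK_in xA xA) Lval_enum mxE [RHS]big_enum_val.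
by apply: eq_bigr => j _; rewrite mxE enum_rankK_in // Lval_enum.
Qed.

(** The sum defining P u at a point of S splits into its parts over S and
over D. *)
Lemma restr_laplacian (R : realType) (X : finType) (a : X -> X -> R)
    (S D : {set X}) (u : Lsp R [set: X]) : S = ~: D ->
  restr S (laplacian a u)
    = Pmx a S D *m restr D u - (1%:M - Pmx a S S) *m restr S u.
Proof.
move=> hS; rewrite /laplacian !mulmxBl !mul1mx.
apply: Lsp_ext => x xS.
rewrite Lval_restr // !LvalB !Lval_Pmx // Lval_restr // opprB addrA.
congr (_ - _); rewrite (bigID (mem D)) /=; congr (_ + _).
  by apply: eq_big => y; rewrite ?inE // => /andP[_ yD]; rewrite Lval_restr.
apply: eq_big => y; first by rewrite hS !inE.
by rewrite -in_setC -hS => /andP[_ yS]; rewrite Lval_restr.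
Qed.

(** With the values on D known, [restr_laplacian] is a square linear system for
the values on S, whose matrix I - P_S has inverse G_S. *)
Lemma dirichlet_solP (R : realType) (X : finType) (E : rel X)
    (a : X -> X -> R) (S D : {set X}) (h : Lsp R S) (u : Lsp R [set: X]) :
    weighted_digraph E a -> D != set0 -> S = ~: D ->
  restr S (laplacian a u) = h <->
  restr S u = - (Green a S *m (h - Pmx a S D *m restr D u)).
Proof.
move=> hG hD hS.
have SU : 1%:M - Pmx a S S \in unitmx.
  apply: Green_unit hG _; rewrite properT hS.
  by apply: contraNneq hD => CD; rewrite -(setCK D) CD setCT.
rewrite (restr_laplacian _ _ hS) /Green; split=> [<-|->].
  by rewrite addrAC subrr add0r mulmxN opprK mulKmx.
by rewrite mulmxN opprK mulKVmx // addrC subrK.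
Qed.

Lemma glue_opp_eqP (R : realType) (X : finType) (A B N : {set X})
    (f : Lsp R A) (g : Lsp R B) (h : Lsp R (A :|: N)) : [disjoint A & N] ->
  h = glue_opp N f g <-> restr A h = f /\ restr N h = - restr N g.
Proof.
move=> dAN; split=> [->|[hA hN]].
  by split; [exact: glue_opp_l | exact: glue_opp_r].
by apply: (@restr_inj _ _ _ A N); rewrite ?subxx // ?glue_opp_l ?glue_opp_r.
Qed.

Theorem mainTheorem13 (R : realType) (X : finType) (E : rel X)
    (a : X -> X -> R) (bd D N : {set X})
    (hG : weighted_digraph E a)
    (hbd : bd = D :|: N) (hdisj : [disjoint D & N])
    (hD : D != set0) (hN : N != set0)
    (f : Lsp R (~: bd)) (g : Lsp R bd) :
  let Xo := ~: bd in
  let solves (u : Lsp R [set: X]) : Prop :=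
    [/\ restr Xo (laplacian a u) = f,
        restr D u = restr D g
      & restr N (normal_deriv a bd u) = restr N g] in
  let ftilde : Lsp R (Xo :|: N) := glue_opp N f g in
  exists u : Lsp R [set: X],
    [/\ solves u,
        forall v : Lsp R [set: X], solves v -> v = u,
        restr (Xo :|: N) u =
          - (Green a (Xo :|: N)
               *m (ftilde - Pmx a (Xo :|: N) D *m restr D g))
      & restr D u = restr D g].
Proof.
move=> Xo solves ftilde.
have hS : Xo :|: N = ~: D.
  apply/setP => x; rewrite /Xo hbd !inE; case: (boolP (x \in N)) => xN.
    by rewrite orbT (disjointFl hdisj xN).
  by rewrite !orbF.
have dXN : [disjoint Xo & N].
  by rewrite -setI_eq0 /Xo hbd setCU -setIA (setIC (~: N)) setICr setI0.
have Nbd : N \subset bd by rewrite hbd subsetUr.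
have solvesP u : solves u <->
    restr D u = restr D g /\ restr (Xo :|: N) (laplacian a u) = ftilde.
  (* The sign in the normal derivative cancels the one in ftilde. *)
  have -> : solves u <-> restr D u = restr D g /\
      (restr Xo (laplacian a u) = f /\
       restr N (laplacian a u) = - restr N g).
    rewrite /solves /normal_deriv restr_restr // restrN.
    split=> [[ef -> <-]|[eD [ef eN]]]; first by rewrite opprK.
    by split=> //; rewrite eN opprK.
  rewrite (glue_opp_eqP f g _ dXN).
  by rewrite !restr_restr ?subsetUl ?subsetUr.
have formulaP u : restr D u = restr D g ->
    restr (Xo :|: N) (laplacian a u) = ftilde <->
    restr (Xo :|: N) u =
      - (Green a (Xo :|: N) *m (ftilde - Pmx a (Xo :|: N) D *m restr D g)).
  by move=> <-; apply: dirichlet_solP hG hD hS.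
have [u [uS uD]] := glue_restr hS
  (- (Green a (Xo :|: N) *m (ftilde - Pmx a (Xo :|: N) D *m restr D g)))
  (restr D g).
exists u; split=> //; first by apply/solvesP; split=> //; apply/formulaP.
move=> v /solvesP[vD /(formulaP _ vD) vS].
apply: (@restr_inj _ _ _ (Xo :|: N) D); rewrite ?vS ?vD //.
by rewrite hS setUC setUCr.
Qed.
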